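(* Let $q$ be a power of an odd prime. The number of congruence classes of nondegenerate triangles in the plane $\mathbb{F}_q^2$ is \[ \frac{q(q^2-1)}{2} \ \text{ if } q \equiv 1 \pmod 4, \qquad \frac{q(q-1)^2}{2} \ \text{ if } q \equiv 3 \pmod 4 . \]
   Context: An $n$-simplex in $\mathbb{F}_q^n$ is an ordered list $[v_0,\dots,v_n]$ of $n+1$ vectors $v_j\in\mathbb{F}_q^n$; it is nondegenerate if $\dim(\operatorname{span}\{v_j - v_0 : 1\le j\le n\}) = n$. A triangle is a $2$-simplex in $\mathbb{F}_q^2$. Let $O(n;q)=\{A\in Mat_n(\mathbb{F}_q): A^TA=I\}$. Two $n$-simplices $[x_0,\dots,x_n]$ and $[y_0,\dots,y_n]$ are congruent if there exist $A\in O(n;q)$ and $b\in\mathbb{F}_q^n$ with $x_i = Ay_i+b$ for $i=0,\dots,n$; the congruence classes are the equivalence classes, i.e. the orbits of the Euclidean group $E(n;q)$ generated by translations and $O(n;q)$. *)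

(* Defs.v *)
From mathcomp Require Import all_boot all_order all_algebra.

Set Implicit Arguments.
Unset Strict Implicit.
Unset Printing Implicit Defensive.

Import GRing.Theory.
Local Open Scope ring_scope.

Definition simplex (F : finFieldType) (n : nat) : finType :=
  {ffun 'I_n.+1 -> 'cV[F]_n}.

(* [lift ord0 j] for [j : 'I_n] runs through the indices 1, ..., n. *)
Definition nondegenerate (F : finFieldType) (n : nat) (v : simplex F n) : bool :=
  \dim <<[seq v (lift ord0 j) - v ord0 | j : 'I_n]>>%VS == n.

Definition orthogonal_set (F : finFieldType) (n : nat) : {set 'M[F]_n} :=
  [set A | A^T *m A == 1%:M].

Definition congruent (F : finFieldType) (n : nat) : rel (simplex F n) :=
  fun x y => [exists A in orthogonal_set F n, exists b : 'cV[F]_n,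
    [forall i, x i == A *m y i + b]].

Lemma congruentP (F : finFieldType) (n : nat) (x y : simplex F n) :
  reflect (exists A : 'M[F]_n, exists b : 'cV[F]_n,
             A^T *m A = 1%:M /\ forall i, x i = A *m y i + b)
          (congruent x y).
Proof.
apply: (iffP 'exists_andP) => [[A []]|[A [b [AO xy]]]].
  rewrite inE => /eqP AO /existsP[b /forallP xy].
  by exists A, b; split=> // i; apply/eqP.
exists A; split; first by rewrite inE AO.
by apply/existsP; exists b; apply/forallP => i; apply/eqP.
Qed.

Lemma congruent_equiv (F : finFieldType) (n : nat) :
  equivalence_rel (@congruent F n).
Proof.
have crefl x : @congruent F n x x.
  apply/congruentP; exists 1%:M, 0; split=> [|i]; first by rewrite trmx1 mul1mx.
  by rewrite mul1mx addr0.
have csym x y : @congruent F n x y -> congruent y x.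
  move=> /congruentP[A [b [AO xy]]]; apply/congruentP; exists A^T, (- (A^T *m b)).
  split=> [|i]; first by rewrite trmxK; apply: mulmx1C.
  by rewrite xy mulmxDr mulmxA AO mul1mx addrK.
have ctrans y x z : @congruent F n x y -> congruent y z -> congruent x z.
  move=> /congruentP[A [b [AO xy]]] /congruentP[B [c [BO yz]]].
  apply/congruentP; exists (A *m B), (A *m c + b); split=> [|i].
    by rewrite trmx_mul mulmxA -(mulmxA B^T) AO mulmx1.
  by rewrite xy yz mulmxDr mulmxA addrA.
move=> x y z; split=> // xy; apply/idP/idP; last exact: ctrans.
by apply: ctrans; apply: csym.
Qed.

Definition nondegenerate_simplices (F : finFieldType) (n : nat) :
  {set simplex F n} := [set v | nondegenerate v].

Definition nondegenerate_congruence_classes (F : finFieldType) (n : nat) :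
  {set {set simplex F n}} :=
  equivalence_partition (@congruent F n) (nondegenerate_simplices F n).

(* Main.v *)
Require Import Defs.
From mathcomp Require Import all_boot all_order all_algebra.
From mathcomp Require Import fingroup finfield ring zify.

(* Makes [nondegenerate] mean the predicate on simplices, not the one on
   bilinear forms. *)
Import Defs.
Import GRing.Theory.
Local Open Scope ring_scope.

(** A nondegenerate simplex amounts to a base vertex together with an
    invertible matrix of edges ([card_nondegenerate_simplices]).  The Euclidean
    group acts freely on these, since a basis of edges determines the linear
    part of a motion and a vertex then determines its translation
    ([rigid_motion_inj]).  All classes therefore have the size of the group,
    and cancelling the [q ^ n] translations against the [q ^ n] base vertices
    shows that the number of classes times [#|O(n; q)|] is [#|GL_n(q)|]
    ([card_congruence_classes_mul]).

    For [n = 2], [#|GL_2(q)| = q * (q - 1) ^ 2 * (q + 1)], and [O(2; q)] is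
    twice as large as the circle [x ^ 2 + y ^ 2 = 1], because a point of the
    circle is the first column of exactly one rotation and one reflection
    ([card_orthogonal2]).  Stereographic projection shows that the circle has
    [q + 1] points minus the number of square roots of [-1] ([card_circle]).
    There are two such roots when [q] is [1] modulo [4] and none when it is
    [3], whence [#|O(2; q)| = 2 * (q - 1)] or [2 * (q + 1)], and the two values
    follow by division. *)

(** * Congruence classes as free orbits *)

Definition edge_mx {F : finFieldType} {n : nat} (v : simplex F n) : 'M[F]_n :=
  \matrix_(i, j) (v (lift ord0 j) - v ord0) i 0.

Definition rigid_motion {F : finFieldType} {n : nat} (v : simplex F n)
    (g : 'M[F]_n * 'cV[F]_n) : simplex F n :=
  [ffun i => g.1 *m v i + g.2].

Lemma nondegenerate_edge_mx (F : finFieldType) (n : nat) (v : simplex F n) :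
  nondegenerate v = (edge_mx v \in unitmx).
Proof.
(* [n] vectors span a space of dimension [n] exactly when they are free. *)
pose e := [tuple v (lift ord0 j) - v ord0 | j < n].
have nondeg_free : nondegenerate v = free e.
  by rewrite /nondegenerate /free size_tuple.
have lincombE (k : 'I_n -> F) :
    \sum_(i < n) k i *: e`_i = edge_mx v *m \col_i k i.
  apply/matrixP=> r c; rewrite summxE mxE ord1; apply: eq_bigr => j _.
  by rewrite -tnth_nth tnth_mktuple !mxE mulrC.
rewrite nondeg_free -unitmx_tr -row_free_unit.
apply/freeP/idP => [eI|/row_free_inj Einj k].
  apply: inj_row_free => u uE; apply/rowP=> i; rewrite mxE.
  apply: eI => //; rewrite lincombE -[RHS]trmx0 -uE trmx_mul trmxK.
  by congr (_ *m _); apply/colP=> j; rewrite !mxE.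
rewrite lincombE => /(congr1 trmx); rewrite trmx_mul trmx0.
rewrite -[RHS](mul0mx _ (edge_mx v)^T) => /Einj /rowP k0 i.
by have := k0 i; rewrite !mxE.
Qed.

Lemma edge_mx_rigid_motion (F : finFieldType) (n : nat) (v : simplex F n) g :
  edge_mx (rigid_motion v g) = g.1 *m edge_mx v.
Proof.
apply/matrixP=> i j; rewrite [LHS]mxE !ffunE opprD addrACA subrr addr0 -mulmxBr !mxE.
by apply: eq_bigr => k _; rewrite !mxE.
Qed.

Lemma orthogonal_unit (F : finFieldType) (n : nat) (A : 'M[F]_n) :
  A \in orthogonal_set F n -> A \in unitmx.
Proof. by rewrite inE => /eqP /mulmx1_unit[]. Qed.

(** This is the freeness of the action: the edges span the space, so their
    images determine the linear part, and then the image of one vertex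
    determines the translation. *)
Lemma rigid_motion_inj (F : finFieldType) (n : nat) (v : simplex F n) :
  nondegenerate v -> injective (rigid_motion v).
Proof.
rewrite nondegenerate_edge_mx => vU [A b] [B c] eq_m.
have AB : A = B.
  have := congr1 edge_mx eq_m; rewrite !edge_mx_rigid_motion /=.
  exact: (can_inj (mulmxK vU)).
by move/ffunP: eq_m => /(_ ord0); rewrite !ffunE /= AB => /addrI ->.
Qed.

(** The class is the image of the Euclidean group under the orbit map; the
    restriction to nondegenerate simplices loses nothing, as a motion multiplies
    the edge matrix by an invertible matrix. *)
Lemma congruence_classE (F : finFieldType) (n : nat) (v : simplex F n) :
  nondegenerate v ->
  [set w in nondegenerate_simplices F n | congruent v w] =
    [set rigid_motion v g | g in setX (orthogonal_set F n) setT].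
Proof.
have csym x y : @congruent F n x y -> congruent y x.
  by move=> xy; have [xx /(_ xy) <-] := congruent_equiv x y x.
move=> vN; apply/setP=> w; rewrite !inE; apply/andP/imsetP.
  case=> _ /csym /congruentP[A [b [AO wE]]]; exists (A, b).
    by rewrite !inE AO eqxx.
  by apply/ffunP=> i; rewrite ffunE.
case=> -[A b]; rewrite in_setX in_setT andbT => AO ->; split.
  rewrite nondegenerate_edge_mx edge_mx_rigid_motion unitmx_mul.
  by rewrite orthogonal_unit // -nondegenerate_edge_mx.
apply: csym; apply/congruentP; exists A, b.
by split=> [|i]; [apply/eqP; rewrite inE in AO | rewrite ffunE].
Qed.

(** Both sides count the pairs of an edge matrix and a base vertex. *)
Lemma card_nondegenerate_simplices (F : finFieldType) (n : nat) :
  #|nondegenerate_simplices F n| =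
    (#|[set M : 'M[F]_n | M \in unitmx]| * #|'cV[F]_n|)%N.
Proof.
pose base_edges (v : simplex F n) := (edge_mx v, v ord0).
have base_edges_inj : injective base_edges.
  move=> v w [/matrixP evw vw0]; apply/ffunP=> i.
  case: (unliftP ord0 i) => [j ->|-> //]; apply/colP=> r.
  by have := evw r j; rewrite !mxE vw0 => /addIr.
rewrite -(card_imset _ base_edges_inj) -cardsT -cardsX; apply: eq_card => -[M b].
rewrite in_setX in_setT inE andbT; apply/imsetP/idP => [[v vN [-> _]]|MU].
  by rewrite -nondegenerate_edge_mx; rewrite inE in vN.
(* [unlift ord0] is undefined exactly at [ord0], so the base vertex is [b]. *)
pose v : simplex F n := [ffun i => b + oapp (fun j => col j M) 0 (unlift ord0 i)].
have vM : edge_mx v = M.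
  by apply/matrixP=> r j; rewrite mxE !ffunE liftK unlift_none /= addr0 addrC addKr mxE.
exists v; first by rewrite inE nondegenerate_edge_mx vM.
by rewrite /base_edges vM ffunE unlift_none addr0.
Qed.

(** By freeness every class has [#|O(n)| * q ^ n] elements; the factor [q ^ n]
    coming from the translations cancels the choice of the base vertex. *)
Theorem card_congruence_classes_mul (F : finFieldType) (n : nat) :
  (#|nondegenerate_congruence_classes F n| * #|orthogonal_set F n| =
     #|[set M : 'M[F]_n | M \in unitmx]|)%N.
Proof.
have class_card : {in nondegenerate_congruence_classes F n,
    forall B : {set simplex F n}, #|B| = #|orthogonal_set F n| * #|'cV[F]_n|}%N.
  move=> B /imsetP[v]; rewrite inE => vN ->.
  by rewrite congruence_classE // card_imset ?cardsX ?cardsT //; apply: rigid_motion_inj.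
have part : partition (nondegenerate_congruence_classes F n)
                      (nondegenerate_simplices F n).
  by apply: equivalence_partitionP => x y z _ _ _; exact: congruent_equiv.
have := card_uniform_partition class_card part.
rewrite card_nondegenerate_simplices mulnA => /eqP.
by rewrite eqn_pmul2r => [/eqP->//|]; apply/card_gt0P; exists 0.
Qed.

Lemma card_unitmx2 (F : finFieldType) :
  #|[set M : 'M[F]_2 | M \in unitmx]| = (#|F| * #|F|.-1 ^ 2 * #|F|.+1)%N.
Proof.
rewrite -card_GL_2 cardsT.
rewrite -(card_imset predT (val_inj : injective (@GLval 2 F))).
apply: eq_card => M; rewrite inE; apply/idP/imsetP => [MU|[A _ ->]].
  by exists (insubd (1%g : {'GL_2[F]}) M); rewrite // [RHS]val_insubd MU.
exact: (valP A).
Qed.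

(** * The circle and the orthogonal group of the plane *)

Definition circle (F : finFieldType) : {set F * F} :=
  [set v | v.1 ^+ 2 + v.2 ^+ 2 == 1].

(** Stereographic projection from [(-1, 0)]: the line of slope [t] through that
    point meets the circle in one further point, unless [t ^+ 2 = -1], in which
    case it meets it nowhere else.  The slopes with [t ^+ 2 != -1] thus
    parametrize the circle without the point of projection. *)
Lemma card_circle (F : finFieldType) :
  2%:R != 0 :> F -> (#|circle F| + #|[set t : F | (t ^+ 2 == -1)%R]| = #|F|.+1)%N.
Proof.
move=> two_neq0.
pose P := [set t : F | 1 + t ^+ 2 != 0].
pose param (t : F) := ((1 - t ^+ 2) / (1 + t ^+ 2), 2%:R * t / (1 + t ^+ 2)).
have param_inj : {in P &, injective param}.
  (* The parameter of a point is the slope of its line to [(-1, 0)]. *)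
  have slope t : t \in P -> (param t).2 / (1 + (param t).1) = t.
    rewrite inE => tP; rewrite /param /=; field.
    have -> : 1 + t ^+ 2 + (1 - t ^+ 2) = 2%:R by ring.
    by rewrite tP.
  by move=> s t sP tP st; rewrite -(slope s sP) st slope.
have circleD1 : circle F :\ (-1, 0) = param @: P.
  apply/setP=> -[x y]; rewrite !inE /=; apply/andP/imsetP.
    case=> xy_neq /eqP xyC.
    have yE : y ^+ 2 = 1 - x ^+ 2 by rewrite -xyC addrAC subrr add0r.
    have x1 : 1 + x != 0.
      apply: contraNneq xy_neq => /eqP; rewrite addrC addr_eq0 => /eqP xE.
      rewrite xpair_eqE xE eqxx /=; move: yE.
      by rewrite xE sqrrN expr1n subrr => /eqP; rewrite sqrf_eq0.
    have tE : 1 + (y / (1 + x)) ^+ 2 = 2%:R / (1 + x).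
      by rewrite expr_div_n yE; field.
    exists (y / (1 + x)); first by rewrite inE tE mulf_neq0 ?invr_eq0.
    rewrite /param tE expr_div_n yE; congr (_, _); field; rewrite ?x1 ?two_neq0 //.
  case=> t; rewrite inE => tP [-> ->]; split; last by apply/eqP; field.
  rewrite xpair_eqE; apply/negP => /andP[/eqP xE _]; case/eqP: two_neq0.
  have := congr1 ( *%R^~ (1 + t ^+ 2)) xE; rewrite divfK // => eq2.
  by transitivity (1 - t ^+ 2 - (-1 * (1 + t ^+ 2))); [ring | rewrite eq2 subrr].
have base_in : (-1, 0) \in circle F by rewrite inE /= sqrrN expr1n expr0n addr0.
rewrite (cardsD1 (-1, 0)) base_in circleD1 card_in_imset // -addnA -(cardsC P).
congr (_.+1); congr (_ + _)%N; apply: eq_card => t.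
by rewrite !inE negbK addrC addr_eq0.
Qed.

(** For [e = 1] this is the rotation with first column [(a, c)], and for
    [e = -1] the reflection with that first column. *)
Definition plane_isometry (F : finFieldType) (u : F * (F * F)) : 'M[F]_2 :=
  let: (e, (a, c)) := u in
  \matrix_(i, j) if j == 0 then (if i == 0 then a else c)
                 else (if i == 0 then - e * c else e * a).

Lemma mx2P (R : Type) (A B : 'M[R]_2) :
  A 0 0 = B 0 0 -> A 0 1 = B 0 1 -> A 1 0 = B 1 0 -> A 1 1 = B 1 1 -> A = B.
Proof.
move=> e00 e01 e10 e11; apply/matrixP.
have ord2 (i : 'I_2) : i = 0 \/ i = 1.
  by case: i => [[|[|//]] ilt]; [left | right]; apply/val_inj.
by move=> i j; case: (ord2 i) => ->; case: (ord2 j) => ->.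
Qed.

(** The first column of a plane isometry is a point of the circle; the second
    one is then determined by the determinant, which is a sign. *)
Lemma card_orthogonal2 (F : finFieldType) :
  2%:R != 0 :> F -> #|orthogonal_set F 2| = (2 * #|circle F|)%N.
Proof.
move=> two_neq0; pose S := setX [set 1; -1 : F] (circle F).
have cardS : #|S| = (2 * #|circle F|)%N.
  have sign_neq : 1 != -1 :> F by rewrite -addr_eq0 -mulr2n.
  by rewrite cardsX cards2 sign_neq.
have sqS (e : F) : (e \in [set 1; -1]) = (e ^+ 2 == 1).
  by rewrite !inE sqrf_eq1.
(* The sign is recovered as the determinant. *)
have iso_inj : {in S &, injective (@plane_isometry F)}.
  move=> [e [a c]] [f [b d]]; rewrite !in_setX !inE /= => /andP[_ /eqP C1] _ eq_iso.
  have /matrixP eq_ij := eq_iso.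
  have := (eq_ij 0 0, eq_ij 1 0, eq_ij 0 1, eq_ij 1 1); rewrite !mxE /=.
  move=> [[[ab cd] eq01] eq11]; rewrite -ab -cd in eq01 eq11 *; congr (_, _).
  rewrite -[e]mulr1 -[f]mulr1 -C1.
  transitivity (e * a * a - (- e * c * c)); first by ring.
  by rewrite eq01 eq11; ring.
rewrite -cardS -(card_in_imset iso_inj); apply: eq_card => A.
have entryE (B : 'M[F]_2) i j :
    (B^T *m B) i j = B 0 i * B 0 j + B 1 i * B 1 j.
  by rewrite mxE big_ord_recl big_ord1 !mxE; congr (_ + B _ _ * B _ _); apply/val_inj.
rewrite inE; apply/eqP/imsetP => [AO|[[e [a c]]]]; last first.
  rewrite in_setX sqS inE /= => /andP[/eqP e1 /eqP C1] ->.
  apply: mx2P; rewrite entryE !mxE /=.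
  - by rewrite -!expr2.
  - by ring.
  - by ring.
  - by transitivity (e ^+ 2 * (a ^+ 2 + c ^+ 2)); [ring | rewrite e1 C1 mulr1].
have := (entryE A 0 0, entryE A 0 1, entryE A 1 1); rewrite AO !mxE /=.
set a := A 0 0; set b := A 0 1; set c := A 1 0; set d := A 1 1.
move=> [[/esym ac_norm /esym ortho] /esym bd_norm].
pose e := a * d - b * c.
have e_sq : e ^+ 2 = 1.
  (* Lagrange's identity for the two columns. *)
  transitivity ((a * a + c * c) * (b * b + d * d) - (a * b + c * d) ^+ 2).
    by rewrite /e; ring.
  by rewrite ac_norm bd_norm ortho expr0n subr0 mulr1.
exists (e, (a, c)); first by rewrite in_setX sqS e_sq eqxx inE /= !expr2 ac_norm eqxx.
apply: mx2P; rewrite !mxE //=.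
- transitivity ((a * a + c * c) * b - (a * b + c * d) * a); last by rewrite /e; ring.
  by rewrite ac_norm ortho mul0r subr0 mul1r.
- transitivity ((a * a + c * c) * d - (a * b + c * d) * c); last by rewrite /e; ring.
  by rewrite ac_norm ortho mul0r subr0 mul1r.
Qed.

(** * Square roots of -1 *)

Lemma two_neq0_odd (F : finFieldType) (p k : nat) :
  prime p -> odd p -> #|F| = (p ^ k)%N -> 2%:R != 0 :> F.
Proof.
move=> p_pr p_odd /card_finPcharP /(_ p_pr) charp.
by rewrite -(dvdn_pcharf charp) dvdn_prime2 //; apply: contraL p_odd => /eqP ->.
Qed.

Lemma expf_card_pred (F : finFieldType) (x : F) : x != 0 -> x ^+ #|F|.-1 = 1.
Proof.
move=> x0; apply: (mulfI x0); rewrite mulr1 -exprS prednK ?expf_card //.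
by apply/card_gt0P; exists x.
Qed.

(** Since [(q - 1) / 2] is odd, a square root [t] of [-1] would satisfy
    [t ^+ (q - 1) = -1], whereas this power is [1]. *)
Lemma card_sqrtN1_3mod4 (F : finFieldType) :
  2%:R != 0 :> F -> (#|F| %% 4 = 3)%N -> #|[set t : F | t ^+ 2 == -1]| = 0%N.
Proof.
move=> two_neq0 F3; apply/eqP; rewrite cards_eq0; apply/eqP/setP=> t.
rewrite !inE; apply/eqP=> t2; case/eqP: two_neq0.
have t0 : t != 0.
  by apply: contra_eq_neq t2 => ->; rewrite expr0n eq_sym oppr_eq0 oner_eq0.
have := expf_card_pred _ _ t0.
have -> : #|F|.-1 = (2 * (#|F| %/ 4).*2.+1)%N by lia.
rewrite exprM t2 -signr_odd /= odd_double expr1 => N1.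
by rewrite mulr2n -{1}N1 addNr.
Qed.

(** If [x ^+ ((q - 1) / 2)] were [1] for every nonzero [x], then
    ['X^((q - 1) / 2) - 1] would have too many roots; so it is [-1] for some
    [x], and [x ^+ ((q - 1) / 4)] is a square root of [-1]. *)
Lemma card_sqrtN1_1mod4 (F : finFieldType) :
  2%:R != 0 :> F -> (#|F| %% 4 = 1)%N -> #|[set t : F | t ^+ 2 == -1]| = 2%N.
Proof.
move=> two_neq0 F1; have F_gt1 : (1 < #|F|)%N := finNzRing_gt1 F.
pose m := (#|F| %/ 4)%N; have m_gt0 : (0 < m)%N by rewrite /m; lia.
have qE : #|F|.-1 = (m.*2 * 2)%N by rewrite /m; lia.
have [x x0 xN1] : exists2 x : F, x != 0 & x ^+ m.*2 != 1.
  apply/exists_inP; apply: contraT; rewrite negb_exists_in => /forall_inP roots1.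
  have p_neq0 : 'X^(m.*2) - 1%:P != 0 :> {poly F}.
    by rewrite -size_poly_eq0 size_XnsubC ?double_gt0.
  have roots_p : all (root ('X^(m.*2) - 1%:P)) (enum [set~ (0 : F)]).
    apply/allP=> x; rewrite mem_enum !inE => /roots1; rewrite negbK => /eqP x1.
    by rewrite /root !hornerE x1 subrr.
  have := max_poly_roots p_neq0 roots_p (enum_uniq _).
  by rewrite size_XnsubC ?double_gt0 // -cardE cardsC1 qE; lia.
have sqN1 : (x ^+ m) ^+ 2 = -1.
  have /eqP : (x ^+ m.*2) ^+ 2 = 1 by rewrite -exprM -qE expf_card_pred.
  by rewrite sqrf_eq1 (negPf xN1) /= -exprM muln2 => /eqP.
have -> : [set t : F | t ^+ 2 == -1] = [set x ^+ m; - x ^+ m].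
  by apply/setP=> t; rewrite !inE -sqN1 eqf_sqr.
rewrite cards2 -addr_eq0 -mulr2n -mulr_natl mulf_neq0 //.
by rewrite expf_neq0.
Qed.

(** * Counting classes of triangles *)

Theorem theorem1p10 (p k q : nat) (p_prime : prime p) (p_odd : odd p)
    (k_gt0 : (0 < k)%N) (q_def : q = (p ^ k)%N)
    (F : finFieldType) (card_F : #|F| = q) :
  ((q %% 4 = 1)%N ->
     #|nondegenerate_congruence_classes F 2|%:R
       = q%:R * (q%:R ^+ 2 - 1) / 2%:R :> rat) /\
  ((q %% 4 = 3)%N ->
     #|nondegenerate_congruence_classes F 2|%:R
       = q%:R * (q%:R - 1) ^+ 2 / 2%:R :> rat).
Proof.
have two_neq0 : 2%:R != 0 :> F.
  by apply: (two_neq0_odd _ _ _ p_prime p_odd); rewrite card_F q_def.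
have := card_congruence_classes_mul F 2.
have := card_circle _ two_neq0; have : (1 < q)%N by rewrite -card_F finNzRing_gt1.
rewrite card_orthogonal2 // card_unitmx2 card_F.
set N := #|nondegenerate_congruence_classes F 2|; set c := #|circle F|.
(* With [q = r + 1], the factor [q - 1] becomes the natural number [r]. *)
case: q {q_def} card_F => // r card_F r_gt0 /= circ orbits.
have rE : r.+1%:R = r%:R + 1 :> rat by rewrite -natr1.
have orbitsQ : N%:R * (2%:R * c%:R) = (r%:R + 1) * r%:R ^+ 2 * (r%:R + 2%:R) :> rat.
  by rewrite -!rE -natrX -natrD addn2 -!natrM orbits.
split=> rmod.
  have cE : c = r.
    by move: circ; rewrite card_sqrtN1_1mod4 ?card_F //; lia.
  have r0 : r%:R != 0 :> rat by rewrite Num.Theory.pnatr_eq0 -lt0n.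
  apply: (mulIf r0); rewrite rE; rewrite cE in orbitsQ.
  transitivity (N%:R * (2%:R * r%:R) / 2%:R : rat); first by field.
  by rewrite orbitsQ; field.
have cE : c = r.+2 by move: circ; rewrite card_sqrtN1_3mod4 ?card_F //; lia.
have r2 : r%:R + 2%:R != 0 :> rat by rewrite -natrD Num.Theory.pnatr_eq0 addn2.
have cQ : c%:R = r%:R + 2%:R :> rat by rewrite cE -addn2 natrD.
apply: (mulIf r2); rewrite rE; rewrite cQ in orbitsQ.
transitivity (N%:R * (2%:R * (r%:R + 2%:R)) / 2%:R : rat); first by field.
by rewrite orbitsQ; field.
Qed.
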